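(* Consider a delay-free, acyclic multisource multicast network for which the network connection problem is solvable, let $T$ be its set of sinks, and let $P=\prod_{t\in T}|M_t|$ be its associated polynomial (with integer coefficients) in the variables $a_{i,j}$, $f_{i,j}$, $b_{t,i,j}$. Linear network coding is possible over $\mathbf{F}_q$ for all prime powers $q>|T|$. Let $p$ be a prime and let $P_p$ be the polynomial over $\mathbf{F}_p$ obtained by reducing the coefficients of $P$ modulo $p$. Each variable $b_{t,i,j}$ appears in $P$ at most in powers of $1$. Therefore, for $q$ a power of $p$, the field $\mathbf{F}_q$ can be used for linear network coding if $P_p$ does not reduce to zero modulo the polynomials $a_{i,j}^q-a_{i,j}$ and $f_{i,j}^q-f_{i,j}$ (one for each variable $a_{i,j}$ and each variable $f_{i,j}$, and none for the variables $b_{t,i,j}$). The following algorithm finds the smallest field of characteristic $p$ for which linear network coding is feasible: try first $\mathbf{F}_q=\mathbf{F}_p$ by this reduction; if this does not work, try $\mathbf{F}_{p^2}$, and so on. To find an $\mathbf{F}_q$ that works one needs at most to try $\lfloor\log_p(|T|)\rfloor$ different fields, since linear network coding is possible whenever $q>|T|$.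
   Context: Network model. $G=(V,E)$ is a finite directed acyclic graph, possibly with parallel edges; $S\subseteq V$ is the set of sources and $T\subseteq V$ the set of sinks. The sources together generate $h$ symbols $X(1),\dots,X(h)\in\mathbf{F}_q$ per unit time, each symbol belonging to one source. Edges are identified with $1,\dots,|E|$; for an edge $j=(u,v)$, $\mathrm{tail}(j)=u$ and $\mathrm{head}(j)=v$. Matrices. $F=(f_{i,j})$ is the $|E|\times|E|$ matrix in which $f_{i,j}$ is a variable if $\mathrm{head}(i)=\mathrm{tail}(j)$ and $f_{i,j}=0$ otherwise. $A=(a_{i,j})$ is the $h\times|E|$ matrix in which $a_{i,j}$ is a variable if edge $j$ is an outgoing edge of the source sending the $i$-th symbol, and $a_{i,j}=0$ otherwise. For each $t\in T$, $B_t=(b_{t,i,j})$ is the $h\times|E|$ matrix in which $b_{t,i,j}$ is a variable if $\mathrm{head}(j)=t$ and $b_{t,i,j}=0$ otherwise. All these variables are distinct. The Edmonds matrix is $M_t=\begin{pmatrix}A&0\\ I-F&B_t^T\end{pmatrix}$, where $I$ is the $|E|\times|E|$ identity matrix, and $|M_t|$ denotes its determinant. Coding. Given values in $\mathbf{F}_q$ of all variables, edge $j$ carries $Y(j)=\sum_{i=1}^h a_{i,j}X(i)+\sum_{i:\mathrm{head}(i)=\mathrm{tail}(j)}f_{i,j}Y(i)$, and sink $t$ records $(b^{(t)}_1,\dots,b^{(t)}_h)$ with $b^{(t)}_i=\sum_{j:\mathrm{head}(j)=t}b_{t,i,j}Y(j)$. Linear network coding is feasible (possible) over $\mathbf{F}_q$,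 i.e. $\mathbf{F}_q$ can be used or works, if there is an assignment of values in $\mathbf{F}_q$ to all the variables $a_{i,j},f_{i,j},b_{t,i,j}$ such that every sink $t\in T$ can recover $X(1),\dots,X(h)$ from $(b^{(t)}_1,\dots,b^{(t)}_h)$, whatever the symbols are. The network connection problem is solvable if linear network coding is feasible over some finite field. Reduction. Reducing a polynomial modulo a collection of polynomials $Z^q-Z$ ($Z$ ranging over some of the variables) means taking the remainder of multivariate division, i.e. repeatedly replacing a factor $Z^q$ in any term by $Z$ until the degree in each such $Z$ is less than $q$ (the result does not depend on the monomial ordering). *)

(* Defs.v *)
From HB Require Import structures.
From mathcomp Require Import all_boot all_order all_algebra all_field.
From mathcomp Require Import mpoly zify.

Set Implicit Arguments.
Unset Strict Implicit.
Unset Printing Implicit Defensive.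

Import GRing.Theory.
Local Open Scope ring_scope.

(* Edges are numbered by 'I_nedges, so parallel edges are allowed; the         *)
(* numbering need not be topological.                                         *)
Record network := Network {
  node : finType;
  nedges : nat;
  etail : 'I_nedges -> node;
  ehead : 'I_nedges -> node;
  sources : {set node};
  sinks : {set node};
  nsym : nat;
  origin : 'I_nsym -> node;
  origin_source : forall i, origin i \in sources;
  (* no closed walk e, s_1, ..., s_k of k + 1 >= 1 edges *)
  acyclic : forall (e : 'I_nedges) (s : seq 'I_nedges),
    ~~ cycle [rel i j | ehead i == etail j] (e :: s)
}.

(* One value for every index, including those where the corresponding matrix  *)
(* entry is 0 and those with t outside the sinks; the latter values are never *)
(* used.                                                                      *)
Record assignment (N : network) (R : Type) := Assignment {
  aval : 'I_(nsym N) -> 'I_(nedges N) -> R;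
  fval : 'I_(nedges N) -> 'I_(nedges N) -> R;
  bval : node N -> 'I_(nsym N) -> 'I_(nedges N) -> R
}.

Section Matrices.

Variables (N : network) (R : pzRingType) (x : assignment N R).

Definition Amx : 'M[R]_(nsym N, nedges N) :=
  \matrix_(i, j) if etail j == origin i then aval x i j else 0.

Definition Fmx : 'M[R]_(nedges N) :=
  \matrix_(i, j) if ehead i == etail j then fval x i j else 0.

Definition Bmx (t : node N) : 'M[R]_(nsym N, nedges N) :=
  \matrix_(i, j) if ehead j == t then bval x t i j else 0.

(* The block matrix has nsym + nedges rows and nedges + nsym columns. *)
Definition edmonds_mx (t : node N) : 'M[R]_(nsym N + nedges N) :=
  castmx (erefl, addnC (nedges N) (nsym N))
    (block_mx Amx 0 (1%:M - Fmx) (Bmx t)^T).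

End Matrices.

Section Coding.

Variables (N : network) (F : fieldType) (x : assignment N F).

(* By acyclicity every X admits exactly one such Y. *)
Definition carries (X : 'I_(nsym N) -> F) (Y : 'I_(nedges N) -> F) : Prop :=
  forall j, Y j = \sum_i Amx x i j * X i
                + \sum_(i | ehead i == etail j) Fmx x i j * Y i.

Definition recorded (t : node N) (Y : 'I_(nedges N) -> F)
    : {ffun 'I_(nsym N) -> F} :=
  [ffun i => \sum_(j | ehead j == t) Bmx x t i j * Y j].

Definition decodable (t : node N) : Prop :=
  exists D : {ffun 'I_(nsym N) -> F} -> 'I_(nsym N) -> F,
    forall X Y, carries X Y -> forall i, D (recorded t Y) i = X i.

End Coding.

Definition feasible (N : network) (F : finFieldType) : Prop :=
  exists x : assignment N F, forall t, t \in sinks N -> decodable x t.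

Definition solvable_network (N : network) : Prop :=
  exists F : finFieldType, feasible N F.

(* Indices of the variables: a_(i,j) and f_(i,j) on the left, b_(t,i,j) on the *)
(* right.  The indices of entries that are 0 name variables that do not occur *)
(* in netpoly.                                                                *)
Definition var (N : network) : finType :=
  (('I_(nsym N) * 'I_(nedges N) + 'I_(nedges N) * 'I_(nedges N))
   + node N * 'I_(nsym N) * 'I_(nedges N))%type.

Definition nvar (N : network) : nat := #|var N|.

Definition avar (N : network) i j : 'I_(nvar N) :=
  enum_rank (inl (inl (i, j)) : var N).
Definition fvar (N : network) i j : 'I_(nvar N) :=
  enum_rank (inl (inr (i, j)) : var N).
Definition bvar (N : network) t i j : 'I_(nvar N) :=
  enum_rank (inr (t, i, j) : var N).

Definition is_af (N : network) : pred 'I_(nvar N) :=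
  fun k => if enum_val k is inl _ then true else false.

Definition generic (N : network) : assignment N {mpoly int[nvar N]} :=
  {| aval := fun i j => 'X_(avar i j);
     fval := fun i j => 'X_(fvar i j);
     bval := fun t i j => 'X_(bvar t i j) |}.

Definition netpoly (N : network) : {mpoly int[nvar N]} :=
  \prod_(t in sinks N) \det (edmonds_mx (generic N) t).

Definition netpoly_mod (N : network) (p : nat) : {mpoly 'F_p[nvar N]} :=
  map_mpoly (fun c : int => c%:~R) (netpoly N).

(* Replacing a factor Z^q of Z^e by Z; e rounds suffice when q > 1. *)
Definition reduce_exp (q e : nat) : nat :=
  iter e (fun d => if q <= d then d - q + 1 else d)%N e.

Lemma reduce_exp_lt (q e : nat) : (1 < q)%N -> (reduce_exp q e < q)%N.
Proof.
move=> q_gt1; rewrite /reduce_exp; set g := (fun d => _).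
suff H k d : (d < q + k)%N -> (iter k g d < q)%N.
  by apply: H; rewrite -[X in (X < _)%N]add0n ltn_add2r ltnW.
elim: k d => [|k IHk] d; first by rewrite addn0.
by move=> lt_d; rewrite iterSr; apply: IHk; rewrite /g => {g}; case: (leqP q d); lia.
Qed.

Definition reduce_mon (n q : nat) (Z : pred 'I_n) (m : 'X_{1..n}) : 'X_{1..n} :=
  [multinom (if Z i then reduce_exp q (m i) else m i) | i < n].

(* The remainder of P modulo the polynomials 'X_i ^+ q - 'X_i for i in Z.      *)
Definition reduce (n : nat) (R : nzRingType) (q : nat) (Z : pred 'I_n)
    (P : {mpoly R[n]}) : {mpoly R[n]} :=
  \sum_(m <- msupp P) P@_m *: 'X_[reduce_mon q Z m].

Definition test (N : network) (p k : nat) : bool :=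
  reduce (p ^ k) (@is_af N) (netpoly_mod N p) != 0.

(* search known ok k tried r: the loop entered at exponent k tries, in order,  *)
(* the exponents in tried and outputs r.  An exponent that is known to work   *)
(* is output without being tried.                                             *)
Inductive search (known ok : pred nat) : nat -> seq nat -> nat -> Prop :=
| SearchKnown k : known k -> search known ok k [::] k
| SearchFound k : ~~ known k -> ok k -> search known ok k [:: k] k
| SearchNext k tried r : ~~ known k -> ~~ ok k ->
    search known ok k.+1 tried r -> search known ok k (k :: tried) r.

Lemma search_deterministic (known ok : pred nat) k tried r tried' r' :
  search known ok k tried r -> search known ok k tried' r' ->
  tried = tried' /\ r = r'.
Proof.
move=> s; elim: s tried' r' => {k tried r}
  [k kn | k nkn okk | k tried r nkn nok _ IH] tried' r' s';
  inversion s'; subst; try by [];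
  try by [move: nkn; rewrite H | move: H; rewrite kn | move: H0; rewrite okk
         | move: nok; rewrite H0].
by case: (IH _ _ H1) => -> ->.
Qed.

Definition is_smallest_field (N : network) (p r : nat) : Prop :=
  exists F : finFieldType,
    [/\ #|F| = (p ^ r)%N, feasible N F &
        forall F' : finFieldType,
          p \in [pchar F'] -> feasible N F' -> (#|F| <= #|F'|)%N].

(* Main.v *)
Require Import Defs.
From mathcomp Require Import all_boot all_order all_algebra all_field.
From mathcomp Require Import perm mpoly.

Set Implicit Arguments.
Unset Strict Implicit.
Unset Printing Implicit Defensive.

Import GRing.Theory.
Local Open Scope ring_scope.

(** A sink decodes iff its Edmonds determinant does not vanish, so coding over
F_q amounts to finding a point of F_q where P does not vanish.  Every entry of
the Edmonds matrix is 0, 1 or plus or minus a variable occurring nowhere else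
in it, so each variable has degree at most 1 in each determinant; and by
acyclicity, whether a determinant is the zero polynomial depends only on the
positions of the nonzero entries, hence not on the characteristic.  A nonzero
polynomial of degree less than q in every variable has a nonzero value over
F_q.  For q > |T| this applies to P itself; in general it applies to the
reduction of P, which has the same values on F_q as P; the b_{t,i,j} need no
reducing, since they occur in M_t only and so have degree at most 1 in P. *)

(** * Polynomial functions over finite fields *)

(** The elements of [F] are pairwise distinct, so their Vandermonde matrix is invertible; its
    inverse supplies the functionals. *)
Lemma dual_powers (F : finFieldType) :
  exists L : 'I_#|F| -> F -> F, forall i j : 'I_#|F|,
    \sum_y L i y * y ^+ j = (j == i)%:R.
Proof.
pose a : 'rV[F]_#|F| := \row_j enum_val j.
have Vu : Vandermonde #|F| a \in unitmx.
  rewrite unitmxE det_Vandermonde unitfE; apply/prodf_neq0 => i _.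
  apply/prodf_neq0 => j lt_ij; rewrite !mxE subr_eq0 (inj_eq enum_val_inj).
  by apply: contraTneq lt_ij => ->; rewrite ltnn.
exists (fun i y => invmx (Vandermonde #|F| a) (enum_rank y) i) => i j.
rewrite (reindex (enum_val (A := predT))) /=; last exact/onW_bij/enum_val_bij.
have /matrixP/(_ j i) := mulmxV Vu; rewrite !mxE => <-.
by apply: eq_bigr => k _; rewrite !mxE enum_valK mulrC.
Qed.

(* The dual functionals of the powers, multiplied over all variables and      *)
(* summed over all points, extract a coefficient from the values of Q.        *)
Lemma mpoly_nonroot (F : finFieldType) n (Q : {mpoly F[n]}) :
    (forall m, m \in msupp Q -> forall i, (m i < #|F|)%N) -> Q != 0 ->
  exists v, Q.@[v] != 0.
Proof.
move=> degQ Qn0; have [L LE] := dual_powers F.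
have [m0 m0Q] : exists m0, m0 \in msupp Q.
  case E: (msupp Q) => [|m0 s]; last by exists m0; rewrite inE eqxx.
  by move: Qn0; rewrite -msupp_eq0 E.
(* On the support the exponents are below [#|F|], so the default of [insubd] is never reached
   there. *)
pose o (m : 'X_{1..n}) (i : 'I_n) : 'I_#|F| := insubd (enum_rank 0) (m i).
have oE m i : m \in msupp Q -> o m i = m i :> nat.
  by move=> mQ; rewrite /o val_insubd degQ.
suff /existsP[v ?] : [exists v : {ffun 'I_n -> F}, Q.@[v] != 0] by exists v.
apply: contraLR m0Q; rewrite negb_exists => /forallP Q0.
rewrite -mcoeff_eq0; apply/eqP.
have: \sum_(v : {ffun 'I_n -> F}) (\prod_i L (o m0 i) (v i)) * Q.@[v] = 0.
  by apply: big1 => v _; move: (Q0 v); rewrite negbK => /eqP->; rewrite mulr0.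
have [m0Q|] := boolP (m0 \in msupp Q); last by rewrite -mcoeff_eq0 => /eqP->.
under eq_bigr => v _.
  rewrite mevalE big_distrr /=.
  under eq_bigr => m _ do rewrite mulrCA -big_split /=.
  over.
rewrite exchange_big /= (bigD1_seq m0) ?msupp_uniq //= [X in _ + X]big1_seq.
  rewrite addr0 -big_distrr.
  rewrite -(bigA_distr_bigA (fun i y => L (o m0 i) y * y ^+ m0 i)).
  rewrite big1 /= ?mulr1 //= => i _.
  by rewrite -(oE _ _ m0Q) LE eqxx.
move=> m /andP[nm mQ].
rewrite -big_distrr -(bigA_distr_bigA (fun i y => L (o m0 i) y * y ^+ m i)) /=.
(* Any other monomial differs from [m0] in some exponent, and the factor of that variable
   vanishes. *)
have [i ni] : exists i, m i != m0 i.
  apply/existsP; rewrite -[X in is_true X]negbK negb_exists.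
  apply: contra nm => /forallP mE; apply/eqP/mnmP => i.
  by apply/eqP; move: (mE i); rewrite negbK.
rewrite (bigD1 i) //= -(oE _ _ mQ) LE -val_eqE /= !oE // (negPf ni).
by rewrite mul0r mulr0.
Qed.

Lemma expf_reduce_exp (F : finFieldType) (x : F) e :
  x ^+ reduce_exp #|F| e = x ^+ e.
Proof.
(* Induction on the number of rounds alone, with the starting exponent fixed. *)
rewrite /reduce_exp; elim: {1}e => //= k IHk.
by case: leqP => // le_q; rewrite exprD expr1 -{2}[x]expf_card -exprD subnK.
Qed.

Lemma map_mpoly_sumE (R S : nzRingType) (phi : {rmorphism R -> S}) n
    (P : {mpoly R[n]}) (g : 'X_{1..n} -> 'X_{1..n}) :
  map_mpoly phi (\sum_(m <- msupp P) P@_m *: 'X_[g m])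
  = \sum_(m <- msupp P) phi P@_m *: 'X_[g m].
Proof.
by rewrite raddf_sum; apply: eq_bigr => m _; rewrite /= map_mpolyZ map_mpolyX.
Qed.

(** Separate rings for coefficients and points let a polynomial over ['F_p] be evaluated over an
    extension field. *)
Lemma meval_reduce (F : finFieldType) (R : nzRingType) (phi : {rmorphism R -> F})
    n (Z : pred 'I_n) (P : {mpoly R[n]}) v :
  (map_mpoly phi (reduce #|F| Z P)).@[v] = (map_mpoly phi P).@[v].
Proof.
rewrite {2}[P]mpolyE (map_mpoly_sumE phi P id) map_mpoly_sumE !raddf_sum.
apply: eq_bigr => m _; rewrite /= !mevalZ !mevalX; congr (_ * _).
by apply: eq_bigr => i _; rewrite mnmE; case: (Z i); rewrite ?expf_reduce_exp.
Qed.

Lemma msupp_reduce (R : nzRingType) n q (Z : pred 'I_n) (P : {mpoly R[n]}) m :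
  m \in msupp (reduce q Z P) ->
  exists2 m', m' \in msupp P & m = reduce_mon q Z m'.
Proof.
move=> /msupp_sum_le/flattenP[s /mapP[m']]; rewrite mem_filter /= => m'P ->.
by move=> /msuppZ_le; rewrite msuppX inE => /eqP ->; exists m'.
Qed.

(** * Degrees in one variable *)

Section Degree.
Variables (n : nat) (R : nzRingType) (k : 'I_n).

Definition degle d (P : {mpoly R[n]}) := forall m, m \in msupp P -> (m k <= d)%N.

Lemma degleW d e P : (d <= e)%N -> degle d P -> degle e P.
Proof. by move=> le_de dP m /dP/leq_trans; apply. Qed.

Lemma degle_sum d (I : Type) (r : seq I) (A : pred I) (P : I -> {mpoly R[n]}) :
  (forall i, A i -> degle d (P i)) -> degle d (\sum_(i <- r | A i) P i).
Proof.
move=> dP; elim/big_ind: _ => // [m|P1 P2 d1 d2 m /msuppD_le].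
  by rewrite msupp0.
by rewrite mem_cat => /orP[/d1|/d2].
Qed.

Lemma degleM d e P Q : degle d P -> degle e Q -> degle (d + e) (P * Q).
Proof.
move=> dP eQ m /msuppM_le/allpairsP[[m1 m2] [/= /dP le1 /eQ le2 ->]].
by rewrite mnmDE leq_add.
Qed.

Lemma degle_prod (I : Type) (r : seq I) (A : pred I) (P : I -> {mpoly R[n]}) d :
  (forall i, A i -> degle (d i) (P i)) ->
  degle (\sum_(i <- r | A i) d i) (\prod_(i <- r | A i) P i).
Proof.
move=> dP; elim/big_rec2: _ => [m|i e Q Ai dQ].
  by rewrite msupp1 inE => /eqP->; rewrite mnm0E.
by apply: degleM => //; apply: dP.
Qed.

Lemma degleN d P : degle d P -> degle d (- P).
Proof. by move=> dP m; rewrite (perm_mem (msuppN _)) => /dP. Qed.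

Lemma degle0 d : degle d 0.
Proof. by move=> m; rewrite msupp0. Qed.

Lemma degle_nat d j : degle d j%:R.
Proof.
move=> m; rewrite -mpolyC_nat msuppC; case: eqP => //= _.
by rewrite inE => /eqP->; rewrite mnm0E.
Qed.

Lemma degleX d j : ((j == k) <= d)%N -> degle d 'X_j.
Proof. by move=> le m; rewrite msuppX inE => /eqP->; rewrite mnm1E. Qed.

(** Each term of the Leibniz expansion takes one entry from each row, so bounds depending on the row
    alone add up to the same total for every permutation. *)
Lemma degle_det h (M : 'M[{mpoly R[n]}]_h) d :
  (forall i j, degle (d i) (M i j)) -> degle (\sum_i d i) (\det M).
Proof.
move=> dM; apply: degle_sum => s _; rewrite -[X in degle X _]add0n.
apply: degleM; last exact: degle_prod.
by case: (odd_perm s); rewrite ?expr1 ?expr0; [apply: degleN|];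
  exact: (@degle_nat 0 1%N).
Qed.

End Degree.

(** * Acyclicity *)

Section Acyclic.
Variable N : network.

Local Notation next := [rel i j | @ehead N i == @etail N j].

Lemma next_connectF e e' : ehead e = @etail N e' -> connect next e' e = false.
Proof.
move=> ee'; apply/connectP => -[p pe lp].
by move: (@acyclic N e' p); rewrite /= rcons_path pe -lp /= ee' eqxx.
Qed.

(** Induction on the number of edges reachable from [e]: by acyclicity, passing to a next edge loses
    at least [e] itself. *)
Lemma downstream_ind (P : 'I_(nedges N) -> Prop) :
  (forall e, (forall e', ehead e = @etail N e' -> P e') -> P e) ->
  forall e, P e.
Proof.
move=> IH e; have [k] := ubnP #|[pred y | connect next e y]|.
elim: k e => // k IHk e; rewrite ltnS => le_k; apply: IH => e' ee'; apply: IHk.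
apply: leq_trans le_k; apply/proper_card/properP; split.
  apply/subsetP => y; rewrite !inE; apply/connect_trans/connect1.
  by rewrite /= ee'.
by exists e; rewrite inE ?connect0 ?next_connectF.
Qed.

Lemma upstream_ind (P : 'I_(nedges N) -> Prop) :
  (forall e, (forall e', ehead e' = @etail N e -> P e') -> P e) ->
  forall e, P e.
Proof.
move=> IH e; have [k] := ubnP #|[pred y | connect next y e]|.
elim: k e => // k IHk e; rewrite ltnS => le_k; apply: IH => e' e'e; apply: IHk.
apply: leq_trans le_k; apply/proper_card/properP; split.
  apply/subsetP => y; rewrite !inE => /connect_trans; apply.
  by apply: connect1; rewrite /= e'e.
by exists e; rewrite !inE ?connect0 ?next_connectF.
Qed.

Lemma ehead_neq_etail e : @ehead N e == etail e = false.
Proof. by apply/eqP => ee; move: (next_connectF ee); rewrite connect0. Qed.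

End Acyclic.

(** * The Edmonds matrix *)

Section Columns.
Variable N : network.

(** Among the columns the edges come before the symbols, the reverse of the row order. *)
Definition ecol e : 'I_(nsym N + nedges N) :=
  cast_ord (addnC (nedges N) (nsym N)) (lshift (nsym N) e).
Definition scol i : 'I_(nsym N + nedges N) :=
  cast_ord (addnC (nedges N) (nsym N)) (rshift (nedges N) i).

Variant col_spec : 'I_(nsym N + nedges N) -> Type :=
| EdgeCol e : col_spec (ecol e)
| SymCol i : col_spec (scol i).

Lemma edge_colP c : col_spec c.
Proof.
rewrite -[c](cast_ordKV (addnC (nedges N) (nsym N))).
by case: (split_ordP (cast_ord (esym (addnC (nedges N) (nsym N))) c)) => j ->;
  constructor.
Qed.

Variant row_spec : 'I_(nsym N + nedges N) -> Type :=
| SymRow i : row_spec (lshift (nedges N) i)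
| EdgeRow e : row_spec (rshift (nsym N) e).

Lemma edge_rowP r : row_spec r.
Proof. by case: (split_ordP r) => j ->; constructor. Qed.

Variables (R : pzRingType) (x : assignment N R) (t : node N).

Lemma edmonds_se i e : edmonds_mx x t (lshift _ i) (ecol e) = Amx x i e.
Proof. by rewrite castmxE /= cast_ord_id cast_ordK block_mxEul. Qed.

Lemma edmonds_ss i j : edmonds_mx x t (lshift _ i) (scol j) = 0.
Proof. by rewrite castmxE /= cast_ord_id cast_ordK block_mxEur mxE. Qed.

Lemma edmonds_ee e e' :
  edmonds_mx x t (rshift _ e) (ecol e') = (e == e')%:R - Fmx x e e'.
Proof. by rewrite castmxE /= cast_ord_id cast_ordK block_mxEdl !mxE. Qed.

Lemma edmonds_es e i : edmonds_mx x t (rshift _ e) (scol i) = Bmx x t i e.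
Proof. by rewrite castmxE /= cast_ord_id cast_ordK block_mxEdr !mxE. Qed.

Definition edmondsE := (edmonds_se, edmonds_ss, edmonds_ee, edmonds_es).

End Columns.

Lemma map_edmonds_mx (N : network) (R R' : pzRingType) (phi : {rmorphism R -> R'})
    (x : assignment N R) (x' : assignment N R') t :
    (forall i j, phi (aval x i j) = aval x' i j) ->
    (forall i j, phi (fval x i j) = fval x' i j) ->
    (forall i j, phi (bval x t i j) = bval x' t i j) ->
  map_mx phi (edmonds_mx x t) = edmonds_mx x' t.
Proof.
move=> pa pf pb; apply/matrixP => r c; rewrite mxE.
case: (edge_rowP r) => i; case: (edge_colP c) => j;
  rewrite !edmondsE ?mxE ?rmorph0 //;
  rewrite ?rmorphB ?rmorph_nat /=; try congr (_ - _);
  by case: ifP => _; rewrite ?rmorph0 ?pa ?pf ?pb.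
Qed.

Section Decoding.
Variables (N : network) (F : fieldType) (x : assignment N F) (t : node N).

Local Notation M := (edmonds_mx x t).

Definition flow_row (X : 'I_(nsym N) -> F) (Y : 'I_(nedges N) -> F) :
  'rV_(nsym N + nedges N) := row_mx (\row_i X i) (- \row_j Y j).

Lemma flow_row_ecol X Y j :
  (flow_row X Y *m M) 0 (ecol j)
  = \sum_i Amx x i j * X i + \sum_(i | ehead i == etail j) Fmx x i j * Y i - Y j.
Proof.
rewrite mxE big_split_ord /= -addrA; congr (_ + _).
  by apply: eq_bigr => i _; rewrite row_mxEl mxE edmondsE mulrC.
under eq_bigr => i _ do rewrite row_mxEr edmondsE !mxE mulNr mulrBr opprB.
rewrite big_split /= [X in _ + X](bigD1 j) //= eqxx mulr1.
rewrite [X in - Y j + X]big1 ?addr0; last first.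
  by move=> i /negPf->; rewrite mulr0 oppr0.
congr (_ + _).
rewrite [RHS]big_mkcond /=; apply: eq_bigr => i _.
by rewrite ?mxE mulrC; case: ifP => // _; rewrite mul0r.
Qed.

Lemma flow_row_scol X Y i : (flow_row X Y *m M) 0 (scol i) = - recorded x t Y i.
Proof.
rewrite mxE big_split_ord /= big1 ?add0r => [|k _]; last by rewrite edmondsE mulr0.
rewrite ffunE [X in - X]big_mkcond /= -sumrN; apply: eq_bigr => j _.
rewrite row_mxEr edmondsE !mxE mulNr mulrC.
by case: ifP => // _; rewrite mul0r oppr0.
Qed.

Lemma carriesP X Y :
  carries x X Y <-> forall j, (flow_row X Y *m M) 0 (ecol j) = 0.
Proof.
split=> c j; first by rewrite flow_row_ecol -c subrr.
by apply/esym/eqP; rewrite -subr_eq0 -flow_row_ecol c.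
Qed.

(** Acyclicity excludes a flow that sustains itself without input: an edge carries zero once all
    edges entering its tail do. *)
Lemma carries0_eq0 Y : carries x (fun=> 0) Y -> forall j, Y j = 0.
Proof.
move=> cY; apply: upstream_ind => j IH; rewrite cY !big1 ?addr0 // => i.
  by move=> /eqP/IH->; rewrite mulr0.
by rewrite mulr0.
Qed.

(* The row vector (X, -Y) is killed by the edge columns of the Edmonds matrix *)
(* iff Y is carried for X, and the other columns then give -recorded t Y.     *)
Lemma decodable_det : decodable x t <-> \det M != 0.
Proof.
split=> [[D DE]|Mn0].
  apply/negP => /det0P[v vn0 vM].
  pose X i := v 0 (lshift _ i); pose Y e := - v 0 (rshift _ e).
  have vE : v = flow_row X Y.
    apply/rowP => c; case: (edge_rowP c) => j; rewrite ?row_mxEl ?row_mxEr !mxE //.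
    by rewrite opprK.
  have cXY : carries x X Y by apply/carriesP => j; rewrite -vE vM mxE.
  (* [D] is an arbitrary function, so the kernel vector is compared with the zero flow: equal
     records force equal symbols. *)
  have c0 : carries x (fun=> 0) (fun=> 0).
    by move=> j; rewrite !big1 ?addr0 // => i _; rewrite mulr0.
  have rY : recorded x t Y = recorded x t (fun=> 0).
    apply/ffunP => i; rewrite -[LHS]opprK -(flow_row_scol X) -vE vM mxE oppr0.
    by rewrite ffunE big1 // => j _; rewrite mulr0.
  have X0 i : X i = 0 by rewrite -(DE _ _ cXY) rY (DE _ _ c0).
  have Y0 : forall j, Y j = 0.
    apply: carries0_eq0 => j; rewrite cXY; congr (_ + _).
    by apply: eq_bigr => i _; rewrite X0.
  case/eqP: vn0; rewrite vE; apply/rowP => c.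
  by case: (edge_rowP c) => j; rewrite ?row_mxEl ?row_mxEr !mxE ?X0 ?Y0 ?oppr0.
(* The record, negated and preceded by zeros, is the product of (X, -Y) with the matrix; inverting
   the matrix exposes X in the first block. *)
exists (fun r i => (castmx (erefl, addnC (nedges N) (nsym N))
  (row_mx 0 (- \row_k r k)) *m invmx M) 0 (lshift _ i)) => X Y cXY i.
set w := castmx _ _; have -> : w = flow_row X Y *m M.
  apply/rowP => c; rewrite castmxE cast_ord_id.
  case: (edge_colP c) => j; rewrite cast_ordK.
    by rewrite row_mxEl mxE (carriesP _ _).1.
  by rewrite row_mxEr flow_row_scol !mxE.
by rewrite mulmxK ?unitmxE ?unitfE // row_mxEl mxE.
Qed.

End Decoding.

(* If the determinant is nonzero, some permutation s avoids the zero entries. *)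
(* Give the variables on s the value 1 and all others 0: then s is the only   *)
(* permutation avoiding the zero entries, because any other would follow the  *)
(* edges of a closed walk.  This makes the determinant 1 or -1 in every field.*)
Lemma det_edmonds_transfer (N : network) (F F' : fieldType) (x : assignment N F) t :
  \det (edmonds_mx x t) != 0 ->
  exists y : assignment N F', \det (edmonds_mx y t) != 0.
Proof.
move=> Mn0.
have [s sM] : exists s : 'S_(nsym N + nedges N),
    forall r, edmonds_mx x t r (s r) != 0.
  suff /existsP[s /forallP] : [exists s : 'S_(nsym N + nedges N),
    [forall r, edmonds_mx x t r (s r) != 0]] by exists s.
  apply: contraR Mn0; rewrite negb_exists => /forallP s0.
  apply/eqP/big1 => s _; move: (s0 s); rewrite negb_forall => /existsP[r].
  by rewrite negbK => /eqP Mr; rewrite (bigD1 r) //= Mr mul0r mulr0.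
pose y : assignment N F' := {| aval := fun i j => (s (lshift _ i) == ecol j)%:R;
             fval := fun i j => (s (rshift _ i) == ecol j)%:R;
             bval := fun _ i j => (s (rshift _ j) == scol i)%:R |}.
exists y.
have offdiag (F1 : fieldType) (z : assignment N F1) e e' : e != e' ->
    edmonds_mx z t (rshift _ e) (ecol e') != 0 -> ehead e = etail e'.
  move=> /negPf ne; rewrite edmondsE mxE ne sub0r oppr_eq0.
  by case: ifP => [/eqP //|]; rewrite eqxx.
(* Off [s], only diagonal entries of the edge block can remain nonzero. *)
have yM r c : edmonds_mx y t r c != 0 -> s r != c ->
    exists2 e, r = rshift _ e & c = ecol e.
  case: (edge_rowP r) => i; case: (edge_colP c) => j;
    rewrite edmondsE ?mxE ?eqxx //=;
    try by case: ifP; rewrite ?eqxx //; case: (s _ == _); rewrite ?eqxx.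
  have [-> _ _|_] := eqVneq i j; first by exists j.
  case: ifP => _; last by rewrite subrr eqxx.
  by case: (s _ == _); rewrite ?subrr ?eqxx.
have s_only (s' : 'S_(nsym N + nedges N)) :
    (forall r, edmonds_mx y t r (s' r) != 0) -> s' = s.
  move=> s'M.
  (* If [s'] leaves [s] at [e], it takes the diagonal there, so the row that it sends to
     [s (rshift _ e)] also leaves [s]. That row belongs to an edge directly downstream of [e],
     against the induction hypothesis. *)
  have Hedge : forall e, s' (rshift _ e) = s (rshift _ e).
    apply: downstream_ind => e IH; apply/esym/eqP/negPn/negP => ne.
    have [e0 /rshift_inj <- {e0} s'e] := yM _ _ (s'M _) ne.
    pose r := (perm_inv s') (s (rshift _ e)).
    have s'r : s' r = s (rshift _ e) by rewrite /r permKV.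
    have nr : s r != s' r.
      rewrite s'r (inj_eq perm_inj); apply: contraNneq ne => rE.
      by rewrite -s'r rE.
    have [e2 rE s'rE] := yM _ _ (s'M _) nr.
    case/eqP: nr; rewrite rE; apply/esym/IH; apply: (offdiag _ x).
      by apply: contraNneq ne => ee2; rewrite -s'r s'rE s'e ee2.
    by rewrite -s'rE s'r.
  apply/permP => r; case: (edge_rowP r) => [i|e]; last exact: Hedge.
  by apply/esym/eqP/negPn/negP => /(yM _ _ (s'M _))[e] /eqP; rewrite eq_lrshift.
rewrite /determinant (bigD1 s) //= [X in _ + X]big1 ?addr0; last first.
  move=> s' /eqP ns'; apply/eqP; rewrite mulf_eq0; apply/orP; right.
  apply/negPn/negP => /prodf_neq0 s'M; apply: ns'; apply: s_only => r.
  exact: s'M.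
rewrite mulf_neq0 ?signr_eq0 //; apply/prodf_neq0 => r _.
move: (sM r); case E: (s r) / (edge_colP (s r)) => [j|j];
  case: (edge_rowP r) E => i E;
  rewrite !edmondsE ?eqxx // !mxE /=.
- by case: ifP => _; rewrite ?eqxx // E eqxx oner_eq0.
(* No edge follows itself, so a diagonal entry is 1; off the diagonal the entry on [s] is -1. *)
- have [->|ne] := eqVneq i j.
    by rewrite ehead_neq_etail !subr0 => _; apply: oner_neq0.
  case: ifP => _; rewrite ?subr0 ?eqxx // E eqxx => _.
  by rewrite sub0r oppr_eq0 oner_eq0.
- by case: ifP => _; rewrite ?eqxx // E eqxx oner_eq0.
Qed.

(** * The polynomial of the network *)

Section Evaluation.
Variables (N : network) (F : fieldType).

Definition eval_int (v : 'I_(nvar N) -> F) (P : {mpoly int[nvar N]}) : F :=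
  (map_mpoly (intmul 1) P).@[v].

Definition point_assignment (v : 'I_(nvar N) -> F) : assignment N F :=
  {| aval := fun i j => v (avar i j);
     fval := fun i j => v (fvar i j);
     bval := fun t i j => v (bvar t i j) |}.

Definition assignment_point (x : assignment N F) (k : 'I_(nvar N)) : F :=
  match enum_val k with
  | inl (inl (i, j)) => aval x i j
  | inl (inr (i, j)) => fval x i j
  | inr (t, i, j) => bval x t i j
  end.

Lemma eval_det_edmonds v t :
  eval_int v (\det (edmonds_mx (generic N) t))
  = \det (edmonds_mx (point_assignment v) t).
Proof.
rewrite -[LHS]/((meval v \o map_mpoly (intmul 1)) _) -det_map_mx /=.
congr (\det _); apply: map_edmonds_mx => i j /=;
  by rewrite map_mpolyX mevalXU.
Qed.

Lemma edmonds_assignment_point x t :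
  edmonds_mx (point_assignment (assignment_point x)) t = edmonds_mx x t.
Proof.
rewrite -[RHS](map_mx_id (fun=> erefl)).
apply/esym/(@map_edmonds_mx _ _ _ idfun) => i j;
  by rewrite /= /assignment_point enum_rankK.
Qed.

Lemma eval_netpoly v :
  eval_int v (netpoly N)
  = \prod_(t in sinks N) \det (edmonds_mx (point_assignment v) t).
Proof.
rewrite /eval_int !rmorph_prod /=.
by apply: eq_bigr => t _; rewrite -eval_det_edmonds.
Qed.

End Evaluation.

Lemma feasibleP (N : network) (F : finFieldType) :
  feasible N F <-> exists v : 'I_(nvar N) -> F, eval_int v (netpoly N) != 0.
Proof.
split=> [[x xD]|[v]].
  exists (assignment_point x); rewrite eval_netpoly; apply/prodf_neq0 => t tS.
  by rewrite edmonds_assignment_point; apply/decodable_det/xD.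
rewrite eval_netpoly => /prodf_neq0 vn0.
by exists (point_assignment v) => t tS; apply/decodable_det/vn0.
Qed.

Section NetworkDegree.
Variable N : network.

(** Within one Edmonds matrix a variable can occur in a single row, which is what makes row bounds
    suffice for the determinant. *)
Definition var_row (k : 'I_(nvar N)) : 'I_(nsym N + nedges N) :=
  match enum_val k with
  | inl (inl (i, _)) => lshift _ i
  | inl (inr (e, _)) => rshift _ e
  | inr (_, _, e) => rshift _ e
  end.

Definition var_at (k : 'I_(nvar N)) (t : node N) : bool :=
  if enum_val k is inr (t', _, _) then t' == t else true.

Lemma degle_edmonds k t r c :
  degle k ((r == var_row k) && var_at k t) (edmonds_mx (generic N) t r c).
Proof.
have rankE (u : var N) : (enum_rank u == k) = (u == enum_val k).
  by rewrite -(inj_eq enum_val_inj) enum_rankK.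
have idx0 d : degle k d (0 : {mpoly int[nvar N]}) by apply: degle0.
case: (edge_rowP r) => i; case: (edge_colP c) => j; rewrite edmondsE ?mxE //=.
- case: ifP => // _; apply: degleX; rewrite rankE /var_row /var_at.
  by case: eqP => // <-; rewrite eqxx.
- suff: degle k ((rshift (nsym N) i == var_row k) && var_at k t)
    (if ehead i == etail j then 'X_(fvar i j) else 0 : {mpoly int[nvar N]}).
    move=> dX m /msuppB_le; rewrite mem_cat => /orP[|/dX //].
    exact: degle_nat.
  case: ifP => // _; apply: degleX; rewrite rankE /var_row /var_at.
  by case: eqP => // <-; rewrite eqxx.
case: ifP => // _; apply: degleX; rewrite rankE /var_row /var_at.
by case: eqP => // <-; rewrite !eqxx.
Qed.

(** The bound counts the sinks whose matrix may contain the variable: all of them for a or f, at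
    most one for b. *)
Lemma degle_netpoly k : degle k (\sum_(t in sinks N) var_at k t) (netpoly N).
Proof.
apply: degle_prod => t _.
have degM := @degle_det _ _ k _ (edmonds_mx (generic N) t)
  (fun r => (r == var_row k) && var_at k t) (@degle_edmonds k t).
apply: degleW degM.
by rewrite (bigD1 (var_row k)) //= eqxx /= big1 ?addn0 // => i /negPf->.
Qed.

Lemma netpoly_deg m k : m \in msupp (netpoly N) -> (m k <= #|sinks N|)%N.
Proof.
move=> /degle_netpoly/leq_trans; apply.
by rewrite -sum1_card; apply: leq_sum => t _; apply: leq_b1.
Qed.

Lemma netpoly_deg_b m k :
  ~~ is_af k -> m \in msupp (netpoly N) -> (m k <= 1)%N.
Proof.
rewrite /is_af => kb /degle_netpoly/leq_trans; apply; rewrite /var_at.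
case: (enum_val k) kb => // -[[t i] j] _.
have [tS|tS] := boolP (t \in sinks N).
  rewrite (bigD1 t) //= eqxx big1 // => t' /andP[_ /negPf].
  by rewrite eq_sym => ->.
by rewrite big1 // => t' t'S; case: eqP tS => // ->; rewrite t'S.
Qed.

End NetworkDegree.

Lemma msupp_map_sub n (R S : nzRingType) (phi : {rmorphism R -> S})
    (P : {mpoly R[n]}) :
  {subset msupp (map_mpoly phi P) <= msupp P}.
Proof.
move=> m; rewrite !mcoeff_msupp mcoeff_map_mpoly.
by apply: contraNneq => ->; rewrite raddf0.
Qed.

(** The field witnessing solvability may have another characteristic. Nonvanishing is transferred
    for each sink separately, at possibly different points; the product is still nonzero,
    polynomials over a field having no zero divisors. *)
Lemma feasible_gt_sinks (N : network) (F : finFieldType) :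
  solvable_network N -> (#|sinks N| < #|F|)%N -> feasible N F.
Proof.
move=> [F0 [x xD]] ltTF; apply/feasibleP/mpoly_nonroot.
  by move=> m /msupp_map_sub mP k; apply: leq_ltn_trans (netpoly_deg k mP) ltTF.
rewrite rmorph_prod; apply/prodf_neq0 => t tS.
have /decodable_det/(det_edmonds_transfer F)[y yn0] := xD t tS.
apply: contraNneq yn0 => M0.
by rewrite -edmonds_assignment_point -eval_det_edmonds /eval_int M0 meval0.
Qed.

(** * The reduction test and the search *)

Lemma rmorphism_from_Fp p (F : finFieldType) :
  p \in [pchar F] -> inhabited {rmorphism 'F_p -> F}.
Proof.
move=> charF; split.
pose phi : {rmorphism 'F_p -> pPrimeCharType charF} :=
  in_alg (pPrimeCharType charF).
exact: phi.
Qed.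

Lemma testP (N : network) p k (F : finFieldType) :
  prime p -> #|F| = (p ^ k)%N -> test N p k <-> feasible N F.
Proof.
move=> p_pr cardF; rewrite /test -cardF.
have [phi] := rmorphism_from_Fp (card_finPcharP cardF p_pr).
have phiP : map_mpoly phi (netpoly_mod N p) = map_mpoly (intmul 1) (netpoly N).
  by apply/mpolyP => m; rewrite !mcoeff_map_mpoly /= rmorph_int.
have evalE v : (map_mpoly phi (reduce #|F| (@is_af N) (netpoly_mod N p))).@[v]
    = eval_int v (netpoly N) by rewrite meval_reduce phiP.
have F_gt1 : (1 < #|F|)%N := finNzRing_gt1 F.
split=> [rn0|/feasibleP[v]]; last first.
  by rewrite -evalE; apply: contraNneq => ->; rewrite raddf0 meval0.
apply/feasibleP; have [] := @mpoly_nonroot F _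
  (map_mpoly phi (reduce #|F| (@is_af N) (netpoly_mod N p))); last first.
- by move=> v; rewrite evalE; exists v.
(* A field morphism is injective, so the reduction stays nonzero over [F]. *)
- apply: contraNneq rn0 => m0; apply/eqP/mpolyP => m; apply: (fmorph_inj phi).
  by rewrite -mcoeff_map_mpoly m0 !mcoeff0 rmorph0.
move=> _ /msupp_map_sub/msupp_reduce[m mP ->] i; rewrite mnmE.
case: ifP => [_|/negbT bi]; first exact: reduce_exp_lt.
exact: leq_ltn_trans (netpoly_deg_b bi (msupp_map_sub mP)) F_gt1.
Qed.

(** Success at [n] guarantees termination, by induction on [n - k]. Only exponents not known to work
    are tried, so they all lie between [k] and [b]. *)
Lemma search_min (known ok : pred nat) k n :
    (forall j, (k <= j)%N -> known j -> ok j) -> (k <= n)%N -> ok n ->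
  exists tried r, [/\ search known ok k tried r, (k <= r)%N, ok r,
    forall j, (k <= j)%N -> ok j -> (r <= j)%N &
    forall b, (forall j, ~~ known j -> (j <= b)%N) ->
      (size tried <= b.+1 - k)%N].
Proof.
move=> known_ok /subnKC <-; move: (n - k)%N => d.
elim: d k known_ok => [|d IHd] k known_ok; last rewrite -addSnnS => ok_n.
  rewrite addn0 => ok_k; have [kn|nkn] := boolP (known k).
    by exists [::], k; split=> //; apply: SearchKnown.
  exists [:: k], k; split=> //; first exact: SearchFound.
  by move=> b /(_ _ nkn); rewrite subn_gt0 ltnS.
have [kn|nkn] := boolP (known k).
  by exists [::], k; split=> //; [apply: SearchKnown | apply: known_ok].
have [ok_k|nok] := boolP (ok k).
  exists [:: k], k; split=> //; first exact: SearchFound.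
  by move=> b /(_ _ nkn); rewrite subn_gt0 ltnS.
have [tried [r [s lt_kr ok_r min_r size_le]]] :=
  IHd _ (fun j lt_kj => known_ok j (ltnW lt_kj)) ok_n.
exists (k :: tried), r; split=> //; first exact: SearchNext.
- exact: ltnW.
- move=> j; rewrite leq_eqVlt => /orP[/eqP <-|]; last exact: min_r.
  by rewrite (negPf nok).
by move=> b kb; rewrite subSn ?(kb _ nkn) // ltnS -subSS size_le.
Qed.

Lemma least_test_smallest (N : network) p r :
    prime p -> (0 < r)%N -> test N p r ->
    (forall j, (0 < j)%N -> test N p j -> (r <= j)%N) ->
  is_smallest_field N p r.
Proof.
move=> p_pr r_gt0 test_r min_r.
have [F charF cardF] := pPrimePowerField p_pr r_gt0.
exists F; split=> //; first exact/(testP N p_pr cardF).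
move=> F' charF' feasF'.
have [k cardF'] : exists k, #|F'| = (p ^ k)%N.
  by eexists; apply: card_pprimeChar charF'.
rewrite cardF cardF' leq_exp2l ?prime_gt1 //; apply: min_r.
  have := finNzRing_gt1 F'.
  by rewrite cardF' -{1}(expn0 p) ltn_exp2l ?prime_gt1.
exact/(testP N p_pr cardF').
Qed.

Theorem mainTheorem1 (N : network) (Nsolvable : solvable_network N) :
  (forall F : finFieldType, (#|sinks N| < #|F|)%N -> feasible N F)
  /\ (forall m, m \in msupp (netpoly N) ->
        forall t i j, (m (bvar (N := N) t i j) <= 1)%N)
  /\ (forall p : nat, prime p ->
        [/\ forall (F : finFieldType) (k : nat), #|F| = (p ^ k)%N ->
              reduce #|F| (@is_af N) (netpoly_mod N p) != 0 -> feasible N F,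
            exists (tried : seq nat) (r : nat),
              search xpred0 (test N p) 1 tried r /\ is_smallest_field N p r
          & exists (tried : seq nat) (r : nat),
              [/\ search (fun k => #|sinks N| < p ^ k)%N (test N p) 1 tried r,
                  is_smallest_field N p r
                & (size tried <= trunc_log p #|sinks N|)%N]]).
Proof.
have big_ok F := @feasible_gt_sinks N F Nsolvable.
split; first exact: big_ok.
split=> [m mP t i j|p p_pr].
  by apply: netpoly_deg_b mP; rewrite /is_af enum_rankK.
have p_gt1 := prime_gt1 p_pr.
have test_big k : (0 < k)%N -> (#|sinks N| < p ^ k)%N -> test N p k.
  move=> k_gt0 lt_k; have [F _ cardF] := pPrimePowerField p_pr k_gt0.
  by apply/(testP N p_pr cardF)/big_ok; rewrite cardF.
(* This exponent makes the power of [p] exceed the number of sinks, so both searches stop. *)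
have test_ok : test N p #|sinks N|.+1.
  by apply: test_big => //; apply/ltnW/ltn_expl.
split=> [F k cardF rn0||].
- by apply/(testP N p_pr cardF); rewrite /test -cardF.
- have [//||tried [r [s r_gt0 ok_r min_r _]]] :=
    @search_min xpred0 _ 1 _ _ _ test_ok => //.
  by exists tried, r; split=> //; apply: least_test_smallest.
have [||tried [r [s r_gt0 ok_r min_r size_le]]] :=
  @search_min (fun k => #|sinks N| < p ^ k)%N _ 1 _ _ _ test_ok => //.
exists tried, r; split=> //; first exact: least_test_smallest.
(* The search starts at 1, so [b.+1 - 1] is the truncated logarithm itself, which bounds every
   exponent with [p ^ j] at most the number of sinks. *)
rewrite -[X in (_ <= X)%N]subn0 -subSS; apply: size_le => j.
by rewrite -leqNgt; apply: trunc_log_max.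
Qed.
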